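(* Let $(\mathbf{A},p,\phi)$ be a categorical probabilistic triple. Suppose that the matrix $Z_\phi$ has magnitude (i.e. has a weighting and a coweighting), and denote its magnitude by $\|Z_\phi\|$. If $Z_\phi$ has a nonnegative weighting $w$ (all entries $\geq 0$), then $u=w/\|Z_\phi\|$ is a probability distribution (on $\operatorname{Ob}(\mathbf{A})$) and $$\mathcal{H}(\mathbf{A},u,\phi)=\ln\|Z_\phi\|.$$
   Context: A categorical probabilistic triple $(\mathbf{A},p,\phi)$ consists of (1) a finite category $\mathbf{A}$; (2) a probability $p$ on the finite set $\operatorname{Ob}(\mathbf{A})$; (3) a function $\phi:\operatorname{Ob}(\mathbf{A})\times\operatorname{Ob}(\mathbf{A})\to[0,\infty)$ such that $\phi(a,a)>0$ for all objects $a$, and $\phi(b,b')=0$ whenever there is no arrow from $b$ to $b'$ in $\mathbf{A}$. The categorical entropy of a triple is $$\mathcal{H}(\mathbf{A},p,\phi):=-\sum_{a\in\operatorname{Ob}(\mathbf{A})}p(a)\ln\Big(\sum_{b\in\operatorname{Ob}(\mathbf{A})}p(b)\phi(a,b)\Big),$$ with the convention that the summand indexed by $a$ is $0$ whenever $p(a)=0$. Enumerate the objects of $\mathbf{A}$ as $a_1,\dots,a_N$, $N=|\operatorname{Ob}(\mathbf{A})|$. Then $Z_\phi$ is the $N\times N$ matrix with $(Z_\phi)_{ij}=\phi(a_i,a_j)$, and vectors in $\mathbb{R}^N$ are identified with functions on $\operatorname{Ob}(\mathbf{A})$. For a matrix $M\in\mathrm{Mat}_{n\times n}(\mathbb{R})$,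 let $1_n$ be the column vector of ones. A weighting of $M$ is a column vector $w\in\mathbb{R}^n$ with $Mw=1_n$; a coweighting of $M$ is a column vector $\bar w\in\mathbb{R}^n$ with $\bar w^TM=1_n^T$. If $M$ has both a weighting $w$ and a coweighting $\bar w$, then $M$ is said to have magnitude, and its magnitude is $\|M\|:=\sum_{i=1}^n w_i=\sum_{i=1}^n\bar w_i$ (these sums agree and are independent of the choices). *)

(* Defs.v *)
From mathcomp Require Import all_boot all_order all_algebra.
From mathcomp Require Import boolp classical_sets reals exp.

Set Implicit Arguments.
Unset Strict Implicit.
Unset Printing Implicit Defensive.

Import Order.TTheory GRing.Theory Num.Theory.

Local Open Scope ring_scope.

Record finCategory : Type := FinCategory {
  ob : finType;
  hom : ob -> ob -> finType;
  idm : forall a : ob, hom a a;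
  comp : forall a b c : ob, hom b c -> hom a b -> hom a c;
  comp_idl : forall (a b : ob) (f : hom a b), comp (idm b) f = f;
  comp_idr : forall (a b : ob) (f : hom a b), comp f (idm a) = f;
  compA : forall (a b c d : ob) (f : hom a b) (g : hom b c) (h : hom c d),
    comp h (comp g f) = comp (comp h g) f
}.

Definition is_probability (R : realType) (T : finType) (p : T -> R) : Prop :=
  (forall a : T, 0 <= p a) /\ \sum_(a : T) p a = 1.

Record catProbTriple (R : realType) (A : finCategory)
    (p : ob A -> R) (phi : ob A -> ob A -> R) : Prop := CatProbTriple {
  triple_prob : is_probability p;
  triple_ge0 : forall a b : ob A, 0 <= phi a b;
  triple_diag : forall a : ob A, 0 < phi a a;
  triple_nohom : forall b b' : ob A, (hom b b' -> False) -> phi b b' = 0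
}.

(* The condition p a != 0 is the convention that the summand at a vanishes
   when p a = 0. For a triple, the logarithm is then taken at a number that is
   at least p a * phi a a > 0, so the value of ln outside the positive reals
   plays no role. *)
Definition cat_entropy (R : realType) (A : finCategory)
    (p : ob A -> R) (phi : ob A -> ob A -> R) : R :=
  - \sum_(a : ob A | p a != 0) p a * ln (\sum_(b : ob A) p b * phi a b).

Definition Zmx (R : realType) (A : finCategory) (phi : ob A -> ob A -> R) :
    'M[R]_#|ob A| :=
  \matrix_(i, j) phi (enum_val i) (enum_val j).

(* Column vectors identified with functions on objects, along the
   enumeration enum_val that orders the rows and columns of Zmx. *)
Definition fun_of_cV (R : realType) (A : finCategory) (w : 'cV[R]_#|ob A|) :
    ob A -> R :=
  fun a => w (enum_rank a) ord0.

Section Magnitude.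
Variables (R : realType) (n : nat).
Implicit Types (M : 'M[R]_n) (w : 'cV[R]_n).

Definition weighting M w : Prop := M *m w = const_mx 1.

Definition coweighting M w : Prop := w^T *m M = (const_mx 1 : 'cV[R]_n)^T.

Definition has_magnitude M : Prop :=
  (exists w, weighting M w) /\ (exists w, coweighting M w).

(* The sum of the entries of a chosen weighting; a junk value if M has no
   weighting. By magnitudeE and magnitude_coE below, it is the sum of the
   entries of every weighting and of every coweighting when M has magnitude. *)
Definition magnitude M : R :=
  \sum_(i < n) (xget 0 [set w | weighting M w]%classic : 'cV[R]_n) i ord0.

Lemma sum_weighting_coweighting M w w' :
  weighting M w -> coweighting M w' ->
  \sum_(i < n) w i ord0 = \sum_(i < n) w' i ord0.
Proof.
move=> Mw Mw'.
have := congr1 (fun v => (v *m w) ord0 ord0) Mw'.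
rewrite /= -mulmxA Mw !mxE => E.
transitivity (\sum_(j < n) (const_mx 1 : 'cV[R]_n)^T ord0 j * w j ord0).
  by apply: eq_bigr => i _; rewrite !mxE mul1r.
by rewrite -E; apply: eq_bigr => i _; rewrite !mxE mulr1.
Qed.

Lemma magnitude_coE M w' : has_magnitude M -> coweighting M w' ->
  magnitude M = \sum_(i < n) w' i ord0.
Proof.
move=> [[w Mw] _]; apply: sum_weighting_coweighting.
exact: (@xgetPex _ 0 [set v | weighting M v]%classic (ex_intro _ w Mw)).
Qed.

Lemma magnitudeE M w : has_magnitude M -> weighting M w ->
  magnitude M = \sum_(i < n) w i ord0.
Proof.
move=> mM Mw; have [_ [w' Mw']] := mM.
by rewrite (magnitude_coE mM Mw') (sum_weighting_coweighting Mw Mw').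
Qed.

End Magnitude.

(* Main.v *)
Require Import Defs.
From mathcomp Require Import all_boot all_order all_algebra.
From mathcomp Require Import boolp classical_sets reals exp.

(** Put m for the magnitude and u = w / m.  The equation Z w = 1 says that
    u averages every row of phi to the same number:
    [\sum_b u b * phi a b = 1 / m] for every object a
    ([weighting_normalized_row]).  All the logarithms in the entropy of u are
    therefore equal to - ln m, and since u has total mass 1 their mean is
    - ln m as well.

    Dividing by m, and u being nonnegative, require m > 0
    ([nonneg_weighting_sum_gt0]): a nonnegative w with sum 0 would vanish, and
    so would Z w, which has entries 1.  This needs at least one object, and
    there is one because p has total mass 1. *)

Set Implicit Arguments.
Unset Strict Implicit.
Unset Printing Implicit Defensive.

Import Order.TTheory GRing.Theory Num.Theory.

Local Open Scope ring_scope.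

Lemma probability_inhabited (R : realType) (T : finType) (p : T -> R) :
  is_probability p -> (0 < #|T|)%N.
Proof.
move=> [_ p1]; rewrite lt0n; apply/eqP => /card0_eq T0.
move: p1; rewrite big_pred0 => [/esym/eqP|//].
by rewrite (negPf (oner_neq0 R)).
Qed.

Lemma sum_fun_of_cV (R : realType) (A : finCategory) (w : 'cV[R]_#|ob A|) :
  \sum_(a : ob A) fun_of_cV w a = \sum_i w i ord0.
Proof.
rewrite (reindex (@enum_val (ob A) xpredT)) /=; last exact/onW_bij/enum_val_bij.
by apply: eq_bigr => i _; rewrite /fun_of_cV enum_valK.
Qed.

(** A vanishing sum of nonnegative entries would force w = 0, against the
    entries 1 of M w; for n = 0 there is no such entry. *)
Lemma nonneg_weighting_sum_gt0 (R : realType) (n : nat) (M : 'M[R]_n)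
    (w : 'cV[R]_n) :
  (0 < n)%N -> weighting M w -> (forall i, 0 <= w i ord0) ->
  0 < \sum_i w i ord0.
Proof.
move=> n_gt0 Mw w_ge0; rewrite lt_def sumr_ge0 // andbT.
apply/eqP => /psumr_eq0P w0.
have := congr1 (fun v : 'cV_n => v (Ordinal n_gt0) ord0) Mw.
rewrite !mxE big1 => [/esym/eqP|j _]; first by rewrite (negPf (oner_neq0 R)).
by rewrite w0 ?mulr0.
Qed.

(** This is the row of index a in the equation Z (c w) = c 1, read on objects
    instead of indices. *)
Lemma weighting_normalized_row (R : realType) (A : finCategory)
    (phi : ob A -> ob A -> R) (w : 'cV[R]_#|ob A|) (c : R) (a : ob A) :
  weighting (Zmx phi) w ->
  \sum_(b : ob A) fun_of_cV (c *: w) b * phi a b = c.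
Proof.
move=> Zw.
have := congr1 (fun v : 'cV_#|ob A| => v (enum_rank a) ord0) Zw.
rewrite !mxE => row1; rewrite -[RHS]mulr1 -row1.
rewrite (reindex (@enum_val (ob A) xpredT)) /=; last exact/onW_bij/enum_val_bij.
rewrite mulr_sumr; apply: eq_bigr => i _.
by rewrite /fun_of_cV !mxE enum_valK enum_rankK -mulrA [phi _ _ * _]mulrC.
Qed.

(** When all the rows of phi have the same average under u, the entropy is the
    mean of a constant.  The summands left out by the condition u a != 0 are 0
    anyway, so the sum may run over all objects. *)
Lemma cat_entropy_const_average (R : realType) (A : finCategory)
    (u : ob A -> R) (phi : ob A -> ob A -> R) (c : R) :
  is_probability u -> (forall a, \sum_b u b * phi a b = c) ->
  cat_entropy u phi = - ln c.
Proof.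
move=> [_ u1] avg; rewrite /cat_entropy; congr (- _).
under eq_bigr do rewrite avg.
rewrite -[RHS]mul1r -u1 mulr_suml [RHS](bigID (fun a => u a != 0)) /=.
rewrite [X in _ = _ + X]big1 ?addr0 // => a.
by rewrite negbK => /eqP ->; rewrite mul0r.
Qed.

Theorem proposition6 (R : realType) (A : finCategory)
    (p : ob A -> R) (phi : ob A -> ob A -> R)
    (triple : catProbTriple p phi)
    (magn : has_magnitude (Zmx phi))
    (w : 'cV[R]_#|ob A|)
    (w_weighting : weighting (Zmx phi) w)
    (w_ge0 : forall i, 0 <= w i ord0) :
  let u : ob A -> R := fun_of_cV ((magnitude (Zmx phi))^-1 *: w) in
  is_probability u /\ cat_entropy u phi = ln (magnitude (Zmx phi)).
Proof.
set m := magnitude _ => u.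
have mE : m = \sum_i w i ord0 by exact: magnitudeE.
have m_gt0 : 0 < m.
  rewrite mE; apply: nonneg_weighting_sum_gt0 w_weighting w_ge0.
  exact: probability_inhabited (triple_prob triple).
have u_prob : is_probability u.
  split=> [a|].
    by rewrite /u /fun_of_cV mxE mulr_ge0 // invr_ge0 ltW.
  rewrite sum_fun_of_cV; under eq_bigr do rewrite mxE.
  by rewrite -mulr_sumr -mE mulVf // gt_eqF.
split=> //.
rewrite (@cat_entropy_const_average _ _ _ _ m^-1) // => [|a].
  by rewrite lnV ?opprK.
exact: weighting_normalized_row.
Qed.
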